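(* Let $m \geq 2$ be an integer. Then, as $i$ ranges over the integers $1 \leq i \leq m$, the quantity $$i(i+1)\left(d_i^2(m)-d_{i+1}(m)\,d_{i-1}(m)\right)$$ attains its minimum at $i=m$, and this minimum value is $$2^{-2m}\,m(m+1)\binom{2m}{m}^2.$$
   Context: For integers $m \geq 0$ and $0\leq i\leq m$, the coefficients of the Boros-Moll polynomials are the rational numbers $$d_i(m)=2^{-2m}\sum_{k=i}^m 2^k\binom{2m-2k}{m-k}\binom{m+k}{k}\binom{k}{i}.$$ That is, $d_i(m)$ is the coefficient of $a^i$ in the polynomial $P_m(a)=2^{-2m}\sum_{k=0}^m 2^k\binom{2m-2k}{m-k}\binom{m+k}{k}(a+1)^k$. By convention, $d_i(m)=0$ for $i<0$ or $i>m$; in particular $d_{m+1}(m)=0$. The notation $d_i^2(m)$ means $(d_i(m))^2$. *)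

(* Defs.v *)
From mathcomp Require Import all_boot all_order all_algebra.

Set Implicit Arguments.
Unset Strict Implicit.
Unset Printing Implicit Defensive.

Import Order.TTheory GRing.Theory Num.Theory.

Local Open Scope ring_scope.

(* The coefficient d_i(m) of 'X^i in the m-th Boros-Moll polynomial. For
   i > m the range of summation is empty, so that d_i(m) = 0. *)
Definition boros_moll (m i : nat) : rat :=
  2 ^- (2 * m) *
  \sum_(i <= k < m.+1)
     2 ^+ k * 'C(2 * m - 2 * k, m - k)%:R * 'C(m + k, k)%:R * 'C(k, i)%:R.

(* Only meant for 0 < i, where the truncated predecessor is i - 1. *)
Definition weighted_log_concavity (m i : nat) : rat :=
  i%:R * i.+1%:R *
  (boros_moll m i ^+ 2 - boros_moll m i.+1 * boros_moll m i.-1).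

(* Main.v *)
Require Import Defs.
From mathcomp Require Import all_boot all_order all_algebra.
From mathcomp Require Import zify ring lra.

Import Order.TTheory GRing.Theory Num.Theory.

Local Open Scope ring_scope.

(** Write [d_i = 4^-m S_i] with [S_i = \sum_k c_k 'C(k, i)]. The two-term
    recurrence of the [c_k] yields a three-term recurrence of the [S_i], which
    turns [i S_i^2 - (i+1) S_(i-1) S_(i+1)] into a positive multiple of
    [((m+1-i) S_i - (i+1) S_(i+1)) ((m+i) S_i - (i+1) S_(i+1))]. Both factors are
    nonnegative because [(i+1) 'C(k, i+1) = (k-i) 'C(k, i)], so
    [i(i+1) (S_i^2 - S_(i+1) S_(i-1)) >= i S_i^2]. For [i < m] the terms [k = m]
    and [k = m-1] of [S_i] already give [S_i >= (m + 1/2) c_m]. *)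

Definition bm_coef (m k : nat) : rat :=
  2 ^+ k * 'C(2 * m - 2 * k, m - k)%:R * 'C(m + k, k)%:R.

(** The range starts at 0, independently of [i], so that sums for different [i] combine term by
    term. *)
Definition bm_sum (m i : nat) : rat :=
  \sum_(0 <= k < m.+1) bm_coef m k * 'C(k, i)%:R.

Lemma boros_mollE m i : boros_moll m i = 2 ^- (2 * m) * bm_sum m i.
Proof.
rewrite /boros_moll /bm_sum; congr (_ * _).
have [le_im|lt_mi] := leqP i m.+1.
  rewrite [RHS](@big_cat_nat _ _ _ i) //= [X in _ = X + _]big_nat [X in _ = X + _]big1 ?add0r //.
  by move=> k /andP[_ lt_ki]; rewrite bin_small ?mulr0.
rewrite big_geq 1?ltnW // big_nat big1 // => k /andP[_ lt_km].
by rewrite bin_small ?mulr0 //; lia.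
Qed.

Lemma bm_coef_ge0 m k : 0 <= bm_coef m k.
Proof. by rewrite !mulr_ge0 ?exprn_ge0 ?ler0n. Qed.

Lemma natr_bin_absorb (k i : nat) :
  i.+1%:R * 'C(k, i.+1)%:R = (k%:R - i%:R) * 'C(k, i)%:R :> rat.
Proof.
have [le_ik|lt_ki] := leqP i k; last by rewrite !bin_small ?mulr0 // ltnW.
by rewrite -natrB // -!natrM mul_bin_left.
Qed.

Lemma central_bin_rec n :
  (n.+1 * 'C(2 * n.+1, n.+1) = 2 * (2 * n + 1) * 'C(2 * n, n))%N.
Proof.
have E1 : (n.+1 * 'C(2 * n.+1, n.+1) = 2 * n.+1 * 'C((2 * n).+1, n))%N.
  by rewrite -mul_bin_diag; congr (_ * 'C(_, _))%N; lia.
have E2 : (n.+1 * 'C((2 * n).+1, n) = (2 * n).+1 * 'C(2 * n, n))%N.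
  have := mul_bin_down (2 * n).+1 n.
  by have -> : ((2 * n).+1 - n = n.+1)%N by lia.
by rewrite E1 -mulnA E2; lia.
Qed.

(** With [n = m - k - 1], the factor [2 * m - 2 * k - 1 = 2 * n + 1] comes from the ratio of
    consecutive central binomials; the rest is absorption in ['C(m + k, k)]. *)
Lemma bm_coef_rec m k : (k < m)%N ->
  (2 * m%:R - 2 * k%:R - 1) * k.+1%:R * bm_coef m k.+1 =
  (m%:R - k%:R) * (m%:R + k%:R + 1) * bm_coef m k.
Proof.
move=> lt_km; have [n Dm] : exists n, m = (n.+1 + k)%N.
  by exists (m - k.+1)%N; lia.
rewrite /bm_coef.
have -> : (2 * m - 2 * k.+1 = 2 * n)%N by lia.
have -> : (2 * m - 2 * k = 2 * n.+1)%N by lia.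
have -> : (m - k.+1 = n)%N by lia.
have -> : (m - k = n.+1)%N by lia.
have mE : m%:R = n%:R + k%:R + 1 :> rat.
  by rewrite Dm natrD -natr1; ring.
have En : n.+1%:R * 'C(2 * n.+1, n.+1)%:R
    = 2 * (2 * n%:R + 1) * 'C(2 * n, n)%:R :> rat.
  by rewrite -[2 * n%:R]natrM natr1 -!natrM central_bin_rec addn1.
have Ek : (m%:R + k%:R + 1) * 'C(m + k, k)%:R
    = k.+1%:R * 'C(m + k.+1, k.+1)%:R :> rat.
  by rewrite -natrD natr1 -!natrM addnS -mul_bin_diag.
rewrite exprS.
transitivity (2 * (2 * n%:R + 1) * 'C(2 * n, n)%:R * 2 ^+ k *
              (k.+1%:R * 'C(m + k.+1, k.+1)%:R) : rat); first by rewrite mE; ring.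
by rewrite -Ek -En mE -natr1; ring.
Qed.

(** Multiply [bm_coef_rec] by ['C(k, j)], sum over [k] and shift the index on one side; absorption
    then removes the dependence on [k] from the polynomial factors. *)
Lemma bm_sum_rec m j :
  (m%:R + j%:R + 1) * (m%:R - j%:R) * bm_sum m j =
  j.+1%:R * ((2 * m%:R + 1) * bm_sum m j.+1 - j.+2%:R * bm_sum m j.+2).
Proof.
have shift :
    \sum_(0 <= k < m.+1)
       (m%:R - k%:R) * (m%:R + k%:R + 1) * bm_coef m k * 'C(k, j)%:R =
    \sum_(0 <= k < m.+1)
       (2 * m%:R - 2 * k%:R + 1) * j.+1%:R * bm_coef m k * 'C(k, j.+1)%:R.
  (* The boundary terms vanish: [k = m] on the left through [m - k], [k = 0] on the right through
     ['C(0, j.+1)]. *)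
  rewrite big_nat_recr // [RHS]big_nat_recl //= subrr !mul0r addr0.
  rewrite mulr0 add0r.
  apply: eq_big_nat => k /andP[_ lt_km].
  rewrite -bm_coef_rec //.
  have := congr1 (fun x : nat => x%:R : rat) (mul_bin_diag k.+1 j).
  rewrite !natrM => E.
  transitivity ((2 * m%:R - 2 * k%:R - 1) * bm_coef m k.+1
                * (k.+1%:R * 'C(k, j)%:R)); first by ring.
  by rewrite E -[in RHS](@natr1 _ k); ring.
apply/eqP; rewrite -subr_eq0; apply/eqP.
transitivity (\sum_(0 <= k < m.+1)
       (m%:R - k%:R) * (m%:R + k%:R + 1) * bm_coef m k * 'C(k, j)%:R -
    \sum_(0 <= k < m.+1)
       (2 * m%:R - 2 * k%:R + 1) * j.+1%:R * bm_coef m k * 'C(k, j.+1)%:R);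
  last by rewrite shift subrr.
rewrite /bm_sum [j.+1%:R * _]mulrBr !mulr_sumr -!sumrB; apply: eq_bigr => k _.
have E1 := natr_bin_absorb k j; have E2 := natr_bin_absorb k j.+1.
set c := bm_coef m k.
(* Two absorptions reduce every binomial to ['C(k, j)], leaving a polynomial identity in [m], [k]
   and [j]. *)
transitivity (c * ((m%:R + j%:R + 1) * (m%:R - j%:R) * 'C(k, j)%:R
  - (2 * m%:R + 1) * (j.+1%:R * 'C(k, j.+1)%:R)
  + j.+1%:R * (j.+2%:R * 'C(k, j.+2)%:R))); first by ring.
rewrite E2 [j.+1%:R * (_ * _)]mulrCA E1.
transitivity (c * ((m%:R - k%:R) * (m%:R + k%:R + 1) * 'C(k, j)%:R
  - (2 * m%:R - 2 * k%:R + 1) * (j.+1%:R * 'C(k, j.+1)%:R))); last by ring.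
by rewrite E1 -(@natr1 _ j); ring.
Qed.

Lemma bm_sum_ge0 m i : 0 <= bm_sum m i.
Proof. by apply: sumr_ge0 => k _; rewrite mulr_ge0 ?bm_coef_ge0 ?ler0n. Qed.

Lemma bm_sum_succ_le m i :
  i.+1%:R * bm_sum m i.+1 <= (m%:R - i%:R) * bm_sum m i.
Proof.
rewrite /bm_sum !mulr_sumr; apply: ler_sum_nat => k /andP[_ le_km].
rewrite mulrCA natr_bin_absorb mulrCA.
apply: ler_wpM2r; first by rewrite mulr_ge0 ?bm_coef_ge0 ?ler0n.
by rewrite lerD2r ler_nat.
Qed.

Lemma bm_sum_log_concave m j : (j < m)%N ->
  j.+2%:R * bm_sum m j * bm_sum m j.+2 <= j.+1%:R * bm_sum m j.+1 ^+ 2.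
Proof.
move=> lt_jm.
have rec := bm_sum_rec m j; have le_yx := bm_sum_succ_le m j.+1.
have x0 := bm_sum_ge0 m j.+1.
have j0 : 0 <= j%:R :> rat by rewrite ler0n.
have jm : j%:R + 1 <= m%:R :> rat by rewrite natr1 ler_nat.
rewrite -(@natr1 _ j) in le_yx rec *.
move: rec le_yx x0.
set x := bm_sum m j.+1; set z := bm_sum m j; set w := bm_sum m j.+2.
have -> : j.+2%:R * z * w = z * (j.+2%:R * w) by ring.
set y := j.+2%:R * w.
set M : rat := m%:R in jm *; set J : rat := j%:R in jm j0 * => rec le_yx x0.
have A0 : 0 < (M + J + 1) * (M - J) by apply: mulr_gt0; lra.
rewrite -(ler_pM2l A0) mulrA rec -subr_ge0.
have -> : (M + J + 1) * (M - J) * ((J + 1) * x ^+ 2)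
    - (J + 1) * ((2 * M + 1) * x - y) * y
  = (J + 1) * (((M - J) * x - y) * ((M + J + 1) * x - y)) by ring.
(* From [le_yx], the first factor is at least [x], and the second exceeds it by
   [(2 * J + 1) * x]. *)
have Jx0 : 0 <= J * x by exact: mulr_ge0.
by rewrite mulr_ge0 ?mulr_ge0 //; lra.
Qed.

(** The last instance of [bm_coef_rec], after cancelling [n + 1]. *)
Lemma bm_coef_pred_last n : 2 * bm_coef n.+1 n = bm_coef n.+1 n.+1.
Proof.
have := @bm_coef_rec n.+1 n (ltnSn n).
rewrite -!(@natr1 _ n) => E.
have n0 : (n%:R + 1 : rat) != 0 by rewrite natr1 pnatr_eq0.
apply: (mulfI n0); apply/eqP; rewrite -subr_eq0; apply/eqP.
by move/eqP: E; rewrite -subr_eq0 => /eqP E; rewrite -oppr0 -E; ring.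
Qed.

Lemma bm_sum_last m : bm_sum m m = bm_coef m m.
Proof.
rewrite /bm_sum big_nat_recr //= binn mulr1 big_nat big1 ?add0r // => k.
by move=> /andP[_ lt_km]; rewrite bin_small ?mulr0.
Qed.

Lemma bm_sum_gt_last m : bm_sum m m.+1 = 0.
Proof.
by rewrite /bm_sum big_nat big1 // => k /andP[_ ?]; rewrite bin_small ?mulr0.
Qed.

Lemma bm_coef_last m : bm_coef m m = 2 ^+ m * 'C(2 * m, m)%:R.
Proof. by rewrite /bm_coef !subnn bin0 mulr1 mul2n addnn. Qed.

Lemma leq_bin_interior m i : (0 < i < m)%N -> (m <= 'C(m, i))%N.
Proof.
elim: m i => [|m IHm] [|i] // lt_im; have {}lt_im : (i < m)%N by [].
rewrite binS; have [Dm|ne_im] := eqVneq i.+1 m.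
  by rewrite -Dm binn binSn.
have := IHm i.+1; have : (0 < 'C(m, i))%N by rewrite bin_gt0 ltnW.
lia.
Qed.

(** The term [k = m] contributes at least [m * c_m], and [k = m - 1] at least [c_m / 2]. This half
    is what lifts the square of the bound above [m * (m + 1) * c_m ^ 2]. *)
Lemma bm_sum_interior m i : (0 < i < m)%N ->
  (m%:R + 2^-1) * bm_coef m m <= bm_sum m i.
Proof.
case: m => [|n] /andP[i0 lt_in]; first by lia.
rewrite /bm_sum !big_nat_recr //= -bm_coef_pred_last.
have S0 : 0 <= \sum_(0 <= k < n) bm_coef n.+1 k * 'C(k, i)%:R.
  by apply: sumr_ge0 => k _; rewrite mulr_ge0 ?bm_coef_ge0 ?ler0n.
have c0 := bm_coef_ge0 n.+1 n; set c := bm_coef n.+1 n in c0 *.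
have B1 : n.+1%:R <= 'C(n.+1, i)%:R :> rat.
  by rewrite ler_nat leq_bin_interior ?i0.
have B2 : 1 <= 'C(n, i)%:R :> rat by rewrite ler1n bin_gt0.
have := ler_wpM2l c0 B1; have := ler_wpM2l c0 B2.
lra.
Qed.

Lemma weighted_log_concavityE m j :
  weighted_log_concavity m j.+1 =
  2 ^- (2 * m) ^+ 2 * (j.+1%:R * j.+2%:R *
    (bm_sum m j.+1 ^+ 2 - bm_sum m j.+2 * bm_sum m j)).
Proof. by rewrite /weighted_log_concavity !boros_mollE /=; ring. Qed.

Lemma weighted_log_concavity_last m : (0 < m)%N ->
  weighted_log_concavity m m =
  2 ^- (2 * m) ^+ 2 * (m%:R * m.+1%:R * bm_coef m m ^+ 2).
Proof.
case: m => // m _.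
by rewrite weighted_log_concavityE bm_sum_gt_last bm_sum_last mul0r subr0.
Qed.

Theorem theorem2p1 (m : nat) (hm : (2 <= m)%N) :
  (forall i : nat, (1 <= i <= m)%N ->
     weighted_log_concavity m m <= weighted_log_concavity m i) /\
  weighted_log_concavity m m =
    2 ^- (2 * m) * m%:R * m.+1%:R * 'C(2 * m, m)%:R ^+ 2.
Proof.
have m0 : (0 < m)%N by exact: ltnW.
rewrite weighted_log_concavity_last //; split; last first.
  (* The squared [2 ^+ m] of [c_m] cancels one of the two factors [2 ^- (2 * m)]. *)
  rewrite bm_coef_last exprMn -exprM [(m * 2)%N]mulnC.
  have : (2 ^+ (2 * m) : rat) != 0 by rewrite expf_neq0.
  by set p := 2 ^+ (2 * m) => p0; field.
case=> [|j] // /andP[_]; rewrite leq_eqVlt => /orP[/eqP <-|lt_jm].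
  by rewrite -weighted_log_concavity_last.
rewrite weighted_log_concavityE ler_wpM2l ?exprn_ge0 ?invr_ge0 ?exprn_ge0 //.
have c0 := bm_coef_ge0 m m.
have lc : j.+2%:R * bm_sum m j * bm_sum m j.+2 <= j.+1%:R * bm_sum m j.+1 ^+ 2.
  exact/bm_sum_log_concave/ltnW.
have le_cx : (m%:R + 2^-1) * bm_coef m m <= bm_sum m j.+1.
  by rewrite bm_sum_interior.
set c := bm_coef m m in c0 le_cx *; set x := bm_sum m j.+1 in lc le_cx *.
have sq : ((m%:R + 2^-1) * c) ^+ 2 <= x ^+ 2.
  rewrite lerXn2r ?nnegrE ?bm_sum_ge0 //.
  by rewrite mulr_ge0 // addr_ge0 // ?ler0n.
(* The chain is [m (m + 1) c^2 <= (m + 1/2)^2 c^2 <= x^2 <= (j + 1) x^2], and the last term is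
   bounded by log-concavity. *)
apply: (@le_trans _ _ (x ^+ 2)).
  apply: le_trans sq; rewrite [leRHS]exprMn.
  apply: ler_wpM2r; first exact: sqr_ge0.
  rewrite -natr1 -subr_ge0.
  have -> : (m%:R + 2^-1) ^+ 2 - m%:R * (m%:R + 1) = 2^-1 ^+ 2 :> rat by field.
  exact: sqr_ge0.
have j1 : 1 <= j.+1%:R :> rat by rewrite ler1n.
apply: (@le_trans _ _ (j.+1%:R * x ^+ 2)).
  by rewrite ler_peMl ?exprn_ge0 ?bm_sum_ge0.
(* Once [j + 1] is cancelled, the goal is a rearrangement of [lc]. *)
rewrite -mulrA ler_pM2l ?ltr0n //.
rewrite -(@natr1 _ j.+1) in lc *.
lra.
Qed.
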